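(* Let $s\ge 1$ be an integer, let $C=\{C_1,\dots,C_s\}$ where each $C_j$ is a (finite or infinite) set of distinct positive integers, let $a=(a_1,\dots,a_s)$ be a tuple of integers, not all zero, and let $z=(z_1,\dots,z_s)$. Let $W_n(z)=W_n(z,C,a)$ be the reciprocal partition polynomials, i.e. the coefficients of the formal power series $1/f(t,z,C,a)=\sum_{n\ge 0}W_n(z)t^n$. Then for every integer $n\ge 1$, $$W_n(z)=\sum_{(k_1,\dots,k_n)\in\pi(n)}(-1)^{k_1+\cdots+k_n}\prod_{j=1}^{n}\left[\frac{1}{k_j!}\left(\frac{\Psi_j(z)}{j}\right)^{k_j}\right].$$
   Context: Here $z_1,\dots,z_s$ are complex numbers (or indeterminates), and all series are formal power series in $t$. The set $\mathbb{N}$ contains $0$. For $n\ge1$, $\pi(n)=\{(k_1,\dots,k_n)\in\mathbb{N}^n : k_1+2k_2+\cdots+nk_n=n\}$. For $n\ge 1$ and $1\le j\le s$, put $\psi^{(j)}_n(z_j)=\sum_{d\in C_j,\ d\mid n} d\,z_j^{n/d}$, and put $\Psi_n(z)=-\sum_{j=1}^{s}a_j\,\psi^{(j)}_n(z_j)$. The formal power series $f$ is $f(t,z,C,a)=\prod_{j=1}^{s}\prod_{m\in C_j}\left(1-z_j t^{m}\right)^{a_j}$. It has constant term $1$, so $1/f(t,z,C,a)$ is a well-defined formal power series in $t$. *)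

(* Defs.v *)
From HB Require Import structures.
From mathcomp Require Import all_boot all_order all_algebra.
From mathcomp Require Import boolp classical_sets filter.

Set Implicit Arguments.
Unset Strict Implicit.
Unset Printing Implicit Defensive.

Import Order.TTheory GRing.Theory Num.Theory.
Local Open Scope ring_scope.

(* Formal power series over R in one variable t: sequences of coefficients with
   the Cauchy product.  The record wrapper keeps this ring apart from functions
   nat -> R with pointwise multiplication. *)
Record fps (R : Type) := FPS { coefs : nat -> R }.

HB.instance Definition _ (R : Type) := gen_eqMixin (fps R).
HB.instance Definition _ (R : Type) := gen_choiceMixin (fps R).

Lemma fpsP (R : Type) (f g : fps R) :
  (forall n, coefs f n = coefs g n) -> f = g.
Proof. by case: f g => [f] [g] /= fg; congr FPS; apply/funext. Qed.

Section FpsZmodule.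
Variable R : zmodType.
Implicit Types f g h : fps R.

Definition fps_zero : fps R := FPS (fun=> 0).
Definition fps_opp f : fps R := FPS (fun n => - coefs f n).
Definition fps_add f g : fps R := FPS (fun n => coefs f n + coefs g n).

Let fps_addA : associative fps_add.
Proof. by move=> f g h; apply/fpsP => n /=; rewrite addrA. Qed.
Let fps_addC : commutative fps_add.
Proof. by move=> f g; apply/fpsP => n /=; rewrite addrC. Qed.
Let fps_add0r : left_id fps_zero fps_add.
Proof. by move=> f; apply/fpsP => n /=; rewrite add0r. Qed.
Let fps_addNr : left_inverse fps_zero fps_opp fps_add.
Proof. by move=> f; apply/fpsP => n /=; rewrite addNr. Qed.

HB.instance Definition _ :=
  GRing.isZmodule.Build (fps R) fps_addA fps_addC fps_add0r fps_addNr.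

Lemma coefs0 n : coefs (0 : fps R) n = 0. Proof. by []. Qed.
Lemma coefsN f n : coefs (- f) n = - coefs f n. Proof. by []. Qed.
Lemma coefsD f g n : coefs (f + g) n = coefs f n + coefs g n. Proof. by []. Qed.
Lemma coefsB f g n : coefs (f - g) n = coefs f n - coefs g n. Proof. by []. Qed.

(* c t^m *)
Definition fps_monom (c : R) (m : nat) : fps R :=
  FPS (fun n => if n == m then c else 0).

End FpsZmodule.

Section FpsComRing.
Variable R : comNzRingType.
Implicit Types f g h : fps R.

Definition fps_one : fps R := fps_monom 1 0.
Definition fps_mul f g : fps R :=
  FPS (fun n => \sum_(i < n.+1) coefs f i * coefs g (n - i)).

Let trunc (N : nat) f : {poly R} := \poly_(i < N.+1) coefs f i.

Let coef_trunc N f n : (n <= N)%N -> (trunc N f)`_n = coefs f n.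
Proof. by move=> nN; rewrite coef_poly ltnS nN. Qed.

Let coefs_mul_trunc N f g n :
  (n <= N)%N -> coefs (fps_mul f g) n = (trunc N f * trunc N g)`_n.
Proof.
move=> nN; rewrite coefM /=; apply: eq_bigr => i _.
by rewrite !coef_trunc ?(leq_trans (leq_subr _ _)) // (leq_trans _ nN) // -ltnS.
Qed.

Let fps_mulC : commutative fps_mul.
Proof.
by move=> f g; apply/fpsP => n; rewrite !(coefs_mul_trunc _ _ (leqnn n)) mulrC.
Qed.

Let fps_mulA : associative fps_mul.
Proof.
move=> f g h; apply/fpsP => n.
transitivity (trunc n f * (trunc n g * trunc n h))`_n.
  rewrite coefM; apply: eq_bigr => i _.
  by rewrite (@coefs_mul_trunc n) ?leq_subr // coef_trunc // -ltnS.
rewrite mulrA coefM; apply: eq_bigr => i _.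
by rewrite (@coefs_mul_trunc n) ?coef_trunc ?leq_subr // -ltnS.
Qed.

Let fps_mul1r : left_id fps_one fps_mul.
Proof.
move=> f; apply/fpsP => n /=; rewrite big_ord_recl /= mul1r subn0.
by rewrite big1 ?addr0 // => i _; rewrite mul0r.
Qed.

Let fps_mulDl : left_distributive fps_mul +%R.
Proof.
move=> f g h; apply/fpsP => n /=; rewrite -big_split /=.
by apply: eq_bigr => i _; rewrite mulrDl.
Qed.

Let fps_one_neq0 : fps_one != 0.
Proof.
apply/eqP => /(congr1 (fun f => coefs f 0)) /= /eqP.
by rewrite (oner_eq0 R).
Qed.

HB.instance Definition _ := GRing.Zmodule_isComNzRing.Build (fps R)
  fps_mulA fps_mulC fps_mul1r fps_mulDl fps_one_neq0.

Lemma coefs1 n : coefs (1 : fps R) n = (n == 0%N)%:R.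
Proof. by rewrite /=; case: eqP. Qed.

Lemma coefsM f g n :
  coefs (f * g) n = \sum_(i < n.+1) coefs f i * coefs g (n - i).
Proof. by []. Qed.

Lemma coefsM0 f g : coefs (f * g) 0 = coefs f 0 * coefs g 0.
Proof. by rewrite coefsM big_ord_recl big_ord0 addr0. Qed.

End FpsComRing.

Section FpsUnitRing.
Variable R : comUnitRingType.
Implicit Types f g : fps R.

Fixpoint fps_inv_seq f (n : nat) : seq R :=
  if n is m.+1 then
    let s := fps_inv_seq f m in
    rcons s (if m == 0%N then (coefs f 0)^-1
             else - (coefs f 0)^-1 * \sum_(i < m) coefs f (m - i) * s`_i)
  else [::].

Definition fps_unit : {pred fps R} := fun f => coefs f 0 \is a GRing.unit.

Definition fps_inv f : fps R :=
  if f \in fps_unit then FPS (fun n => (fps_inv_seq f n.+1)`_n) else f.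

Let size_inv_seq f n : size (fps_inv_seq f n) = n.
Proof. by elim: n => //= n IHn; rewrite size_rcons IHn. Qed.

Let nth_inv_seq f n i :
  (i < n)%N -> (fps_inv_seq f n)`_i = (fps_inv_seq f i.+1)`_i.
Proof.
elim: n => // n IHn; rewrite ltnS leq_eqVlt => /predU1P[-> //|ltin].
by rewrite -(IHn ltin) [fps_inv_seq f n.+1]/= nth_rcons size_inv_seq ltin.
Qed.

Let fps_mulVx : {in fps_unit, left_inverse 1 fps_inv *%R}.
Proof.
move=> f fU; apply/fpsP => n; rewrite mulrC coefsM coefs1 /fps_inv fU /=.
have f0U : coefs f 0 \is a GRing.unit by [].
under eq_bigr do rewrite -[rcons _ _]/(fps_inv_seq f _.+1).
case: n => [|n]; first by rewrite big_ord_recl big_ord0 /= addr0 divrr.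
rewrite big_ord_recl subn0 {1}/fps_inv_seq -/fps_inv_seq.
rewrite -[rcons (fps_inv_seq f n) _]/(fps_inv_seq f n.+1).
rewrite nth_rcons size_inv_seq ltnn eqxx mulNr mulrN mulVKr //.
apply/eqP; rewrite addrC subr_eq0; apply/eqP.
rewrite (reindex_inj rev_ord_inj) /=; apply: eq_bigr => i _.
rewrite -[rcons _ _]/(fps_inv_seq f (n.+1 - bump 0 (n.+1 - i.+1)).+1).
rewrite -[rcons _ _]/(fps_inv_seq f n.+1).
rewrite /bump add1n !subSS subKn; last by rewrite -ltnS.
by rewrite [in RHS]nth_inv_seq // subSn // -ltnS.
Qed.

Let fps_unitPl f g : g * f = 1 -> fps_unit f.
Proof.
move=> /(congr1 (fun h => coefs h 0)); rewrite coefsM0 coefs1 /= => gf.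
by apply/unitrPr; exists (coefs g 0); rewrite mulrC.
Qed.

Let fps_inv_out : {in [predC fps_unit], fps_inv =1 id}.
Proof. by move=> f /negbTE fU; rewrite /fps_inv [_ \in _]fU. Qed.

HB.instance Definition _ := GRing.ComNzRing_hasMulInverse.Build (fps R)
  fps_mulVx fps_unitPl fps_inv_out.

Lemma fps_unitE f : (f \is a GRing.unit) = (coefs f 0 \is a GRing.unit).
Proof. by []. Qed.

End FpsUnitRing.

Section InfiniteProducts.
Variable R : comUnitRingType.
Implicit Types (P F : nat -> fps R) (L : fps R) (A : set nat).

Local Open Scope classical_set_scope.

(* t-adic convergence: each coefficient of P N is eventually that of L. *)
Definition fps_cvg P L : Prop :=
  forall n, \forall N \near \oo, coefs (P N) n = coefs L n.

Definition fps_lim P : fps R := xget 0 [set L | fps_cvg P L].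

Definition fps_prod A F : fps R :=
  fps_lim (fun N => \prod_(0 <= m < N | m \in A) F m).

Lemma fps_cvg_lim P L : fps_cvg P L -> fps_lim P = L.
Proof.
move=> PL; rewrite /fps_lim; case: xgetP => [L' _ PL'|/(_ L)//].
apply/fpsP => n; have [N [<- //]] : exists N,
    coefs (P N) n = coefs L' n /\ coefs (P N) n = coefs L n.
have [N1 _ H1] := PL' n; have [N2 _ H2] := PL n.
by exists (maxn N1 N2); split; [apply: H1|apply: H2];
  rewrite /= leq_max leqnn ?orbT.
Qed.

(* f = 1 modulo t^m *)
Definition fps_near1 (m : nat) (f : fps R) : Prop :=
  forall i, (i < m)%N -> coefs f i = coefs (1 : fps R) i.

Let coefsM_low (m : nat) (f g : fps R) :
  (forall i, (i < m)%N -> coefs f i = 0) ->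
  forall i, (i < m)%N -> coefs (f * g) i = 0.
Proof.
move=> f0 i im; rewrite coefsM big1 // => j _; rewrite f0 ?mul0r //.
by rewrite (leq_trans _ im) // ltnS -ltnS.
Qed.

Let coefsM_near1 (m : nat) (f g : fps R) : fps_near1 m g ->
  forall i, (i < m)%N -> coefs (f * g) i = coefs f i.
Proof.
move=> g1 i im; apply/eqP; rewrite -subr_eq0 -coefsB -{2}[f]mulr1 -mulrBr mulrC.
by rewrite (@coefsM_low m) // => k km; rewrite coefsB g1 ?subrr.
Qed.

Lemma fps_near1_exprz (m : nat) (f : fps R) (a : int) :
  (0 < m)%N -> fps_near1 m f -> fps_near1 m (f ^ a).
Proof.
move=> m0 f1.
have near1X k : fps_near1 m (f ^+ k).
  elim: k => [|k IHk]; first by rewrite expr0.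
  by move=> i im; rewrite exprSr (coefsM_near1 _ f1) ?IHk.
case: a => k; first exact: near1X.
have fU : f ^+ k.+1 \is a GRing.unit.
  by rewrite fps_unitE near1X // coefs1 unitr1.
move=> i im; rewrite -[f ^ _]/(f ^- k.+1).
by rewrite -(coefsM_near1 _ (near1X k.+1)) // mulVr.
Qed.

Lemma fps_prod_cvg A F : (forall m, A m -> fps_near1 m (F m)) ->
  fps_cvg (fun N => \prod_(0 <= m < N | m \in A) F m) (fps_prod A F).
Proof.
move=> F1; set P := fun N : nat => _.
suff PL : fps_cvg P (FPS (fun n => coefs (P n.+1) n)).
  by rewrite /fps_prod (fps_cvg_lim PL).
have PS N : P N.+1 = P N * (if N \in A then F N else 1).
  by rewrite /P big_mkcond big_nat_recr //= -big_mkcond.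
move=> n; exists n.+1 => // N /= nN; rewrite -(subnKC nN).
elim: (N - n.+1)%N => [|k IHk]; first by rewrite addn0.
rewrite addnS PS -[RHS]IHk.
case: ifPn => [|_]; last by rewrite mulr1.
rewrite inE => /F1 Fm1; apply: (coefsM_near1 _ Fm1).
by rewrite addSn ltnS leq_addr.
Qed.

End InfiniteProducts.

Section ReciprocalPartitionPolynomials.
Variables (R : comUnitRingType) (s : nat).
Variables (z : 'I_s -> R) (C : 'I_s -> set nat) (a : 'I_s -> int).

Definition fser : fps R :=
  \prod_(j < s) fps_prod (C j) (fun m => (1 - fps_monom (z j) m) ^ (a j)).

Definition W (n : nat) : R := coefs fser^-1 n.

Definition psi (j : 'I_s) (n : nat) : R :=
  \sum_(d <- divisors n | d \in C j) d%:R * z j ^+ (n %/ d).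

Definition Psi (n : nat) : R := - \sum_(j < s) (a j)%:~R * psi j n.

Lemma fser_factor_cvg (j : 'I_s) : ~ C j 0%N ->
  fps_cvg (fun N => \prod_(0 <= m < N | m \in C j)
                      (1 - fps_monom (z j) m) ^ (a j))
          (fps_prod (C j) (fun m => (1 - fps_monom (z j) m) ^ (a j))).
Proof.
move=> C0; apply: fps_prod_cvg => m Cm.
apply: fps_near1_exprz; first by case: m Cm.
by move=> i im; rewrite coefsB /= (ltn_eqF im) subr0.
Qed.

Lemma coefs_fser0 : (forall j, ~ C j 0%N) -> coefs fser 0 = 1.
Proof.
move=> C0; rewrite /fser.
elim/big_ind: _ => [|f g f0 g0|j _]; rewrite ?coefs1 ?coefsM0 ?f0 ?g0 ?mulr1 //.
have [N _ /(_ _ (leqnn N)) <-] := fser_factor_cvg (C0 j) 0%N.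
elim/big_ind: _ => [|f g f0 g0|m]; rewrite ?coefs1 ?coefsM0 ?f0 ?g0 ?mulr1 //.
rewrite inE => Cm; have m0 : (0 < m)%N by case: m Cm => // /C0.
rewrite (@fps_near1_exprz _ m) ?coefs1 // => i im.
by rewrite coefsB /= (ltn_eqF im) subr0.
Qed.

Lemma fser_unit : (forall j, ~ C j 0%N) -> fser \is a GRing.unit.
Proof. by move=> C0; rewrite fps_unitE coefs_fser0 ?unitr1. Qed.

End ReciprocalPartitionPolynomials.

(* pi(n); the index j : 'I_n stands for the position j + 1.  A solution has all
   its entries at most n (partsP), so bounding them loses nothing. *)
Definition parts (n : nat) : {set {ffun 'I_n -> 'I_n.+1}} :=
  [set k : {ffun 'I_n -> 'I_n.+1} | \sum_(j < n) j.+1 * k j == n]%N.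

Lemma partsP (n : nat) (k : 'I_n -> nat) :
  (\sum_(j < n) j.+1 * k j)%N = n <->
  exists2 k' : {ffun 'I_n -> 'I_n.+1}, k' \in parts n & forall j, k j = k' j.
Proof.
split=> [kn|[k' + kk']]; last first.
  rewrite inE => /eqP kn; apply: etrans kn.
  by apply: eq_bigr => j _; rewrite kk'.
have kle j : (k j < n.+1)%N.
  rewrite ltnS (leq_trans _ (eq_leq kn)) // (bigD1 j) //=.
  by rewrite mulSn -addnA leq_addr.
exists [ffun j => Ordinal (kle j)]; last by move=> j; rewrite ffunE.
rewrite inE; apply/eqP; apply: etrans kn.
by apply: eq_bigr => j _; rewrite ffunE.
Qed.

(* Main.v *)
Require Import Defs.
From mathcomp Require Import all_boot all_order all_algebra.
From mathcomp Require Import boolp classical_sets filter.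

Set Implicit Arguments.
Unset Strict Implicit.
Unset Printing Implicit Defensive.

Import Order.TTheory GRing.Theory Num.Theory.
Local Open Scope ring_scope.

(** Both sides are the coefficient of t^n in exp (- sum_(j >= 1) Psi_j t^j / j),
    and this is proved without logarithms of power series, by comparing
    logarithmic derivatives.  Let D = t d/dt, and say that
    f has logarithmic derivative g when D f = f g.  Logarithmic derivatives add
    over products, change sign under inversion, scale under integer powers and
    pass to t-adic limits.

    - The logarithmic derivative of 1 - z t^m is the opposite of the sum of the
      m z^k t^(m k) over k >= 1.  Summed over j and over m in C_j with weights
      a_j, and collecting the terms with m k = n, this gives Psi_n as the
      coefficient of t^n in D f / f for n >= 1 ([logder_fser]).  So 1/f has the
      opposite series as logarithmic derivative.

    - The series exp (x t^m) = sum_k x^k / k! t^(m k) has logarithmic derivative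
      m x t^m ([logder_expm]).  Taking x = - Psi_m / m, the product of these
      exponentials over 1 <= m <= n has the same logarithmic derivative as 1/f
      modulo t^(n+1).  Expanding the product of sums, its coefficient of t^n is
      the sum over pi(n) of the theorem ([coefs_prod_expm]).

    Two series with constant term 1 and congruent logarithmic derivatives are
    congruent, since their quotient h satisfies D h = 0 modulo t^(n+1) and the
    positive integers are invertible ([logder_inj]). *)

(** * Congruences and monomials *)

Section Congruence.
Variable R : comNzRingType.
Implicit Types f g : fps R.

(** Congruence modulo t^(n+1). *)
Definition fps_eqmod (n : nat) f g : Prop :=
  forall i, (i <= n)%N -> coefs f i = coefs g i.

Lemma fps_eqmodM n f f' g g' :
  fps_eqmod n f f' -> fps_eqmod n g g' -> fps_eqmod n (f * g) (f' * g').
Proof.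
move=> ff' gg' i le_in; rewrite !coefsM; apply: eq_bigr => k _.
by rewrite ff' ?gg' // (leq_trans _ le_in) ?leq_subr // -ltnS.
Qed.

Lemma fps_eqmod_prod n (I : Type) (r : seq I) (F G : I -> fps R) :
  (forall i, fps_eqmod n (F i) (G i)) ->
  fps_eqmod n (\prod_(i <- r) F i) (\prod_(i <- r) G i).
Proof.
by move=> FG; elim/big_ind2: _ => // f f' g g' ff' gg'; exact: fps_eqmodM.
Qed.

Lemma coefs_sum (I : Type) (r : seq I) (P : pred I) (F : I -> fps R) n :
  coefs (\sum_(i <- r | P i) F i) n = \sum_(i <- r | P i) coefs (F i) n.
Proof. exact: (big_morph (fun f => coefs f n) (fun f g => coefsD f g n)). Qed.

Lemma coefsMn f k n : coefs (f *+ k) n = coefs f n *+ k.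
Proof. by elim: k => // k IHk; rewrite !mulrS coefsD IHk. Qed.

Lemma coefsMz f (c : int) n : coefs (f *~ c) n = coefs f n *~ c.
Proof. by case: c => k; rewrite ?NegzE ?mulrNz ?coefsN -!pmulrn coefsMn. Qed.

Lemma coefs_monomM (c : R) m f n :
  coefs (fps_monom c m * f) n = if (m <= n)%N then c * coefs f (n - m) else 0.
Proof.
rewrite coefsM; case: ifP => [le_mn|gt_mn].
  rewrite (bigD1 (Ordinal (le_mn : m < n.+1)%N)) //= eqxx big1 ?addr0 // => i.
  by rewrite -val_eqE /= => /negbTE ->; rewrite mul0r.
apply: big1 => i _ /=; case: eqP => [im|]; last by rewrite mul0r.
by rewrite -im -ltnS ltn_ord in gt_mn.
Qed.

Lemma monomM (c d : R) m n :
  fps_monom c m * fps_monom d n = fps_monom (c * d) (m + n).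
Proof.
apply/fpsP => i; rewrite coefs_monomM /=; case: leqP => [le_mi|lt_im].
  by rewrite -(eqn_add2l m) subnKC //; case: eqP; rewrite ?mulr0.
by case: eqP => // im; rewrite im ltnNge leq_addr in lt_im.
Qed.

Lemma monom_prod (I : Type) (r : seq I) (c : I -> R) (m : I -> nat) :
  \prod_(i <- r) fps_monom (c i) (m i) =
  fps_monom (\prod_(i <- r) c i) (\sum_(i <- r) m i)%N.
Proof.
elim: r => [|i r IHr]; first by rewrite !big_nil.
by rewrite !big_cons IHr monomM.
Qed.

End Congruence.

(** * Logarithmic derivatives *)

Section LogarithmicDerivative.
Variable R : comUnitRingType.
Implicit Types f g h : fps R.

(** The derivation D = t d/dt is preferred to d/dt because it does not shift
    the coefficients. *)
Definition fps_euler f : fps R := FPS (fun n => coefs f n *+ n).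

Lemma eulerM f g : fps_euler (f * g) = fps_euler f * g + f * fps_euler g.
Proof.
apply/fpsP => n; rewrite coefsD !coefsM /= -big_split -sumrMnl.
apply: eq_bigr => i _ /=.
by rewrite mulrnAl mulrnAr -mulrnDr subnKC // -ltnS.
Qed.

(** g stands for D f / f; stated without a quotient, the relation passes to
    limits with no invertibility condition. *)
Definition logder f g : Prop := fps_euler f = f * g.

Lemma logder1 : logder 1 0.
Proof. by apply/fpsP => -[|n]; rewrite mulr0 //= mul0rn. Qed.

Lemma logderM f f' g g' :
  logder f g -> logder f' g' -> logder (f * f') (g + g').
Proof.
by rewrite /logder eulerM => -> ->; rewrite mulrDr mulrAC mulrA.
Qed.

Lemma logder_prod (I : Type) (r : seq I) (P : pred I) (F G : I -> fps R) :
  (forall i, P i -> logder (F i) (G i)) ->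
  logder (\prod_(i <- r | P i) F i) (\sum_(i <- r | P i) G i).
Proof.
move=> FG; elim/big_ind2: _ => //; first exact: logder1.
by move=> f g f' g'; apply: logderM.
Qed.

Lemma logderV f g : f \is a GRing.unit -> logder f g -> logder f^-1 (- g).
Proof.
move=> fU fg; apply: (mulrI fU); rewrite mulrA divrr // mul1r.
have := eulerM f f^-1; rewrite divrr // logder1 mulr0 fg.
rewrite mulrAC divrr // mul1r => /esym/eqP.
by rewrite addrC addr_eq0 => /eqP.
Qed.

Lemma logderXz f g (c : int) :
  f \is a GRing.unit -> logder f g -> logder (f ^ c) (g *~ c).
Proof.
move=> fU fg.
have logderX k : logder (f ^+ k) (g *+ k).
  elim: k => [|k IHk]; first exact: logder1.
  by rewrite exprS mulrS; apply: logderM.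
case: c => k; first exact: logderX.
by rewrite NegzE mulrNz; apply: logderV; rewrite ?unitrX.
Qed.

(** Coefficient n of both sides of D f = f g depends only on the coefficients
    up to n. *)
Lemma logder_approx f g :
  (forall n, exists f' g',
     [/\ logder f' g', fps_eqmod n f' f & fps_eqmod n g' g]) ->
  logder f g.
Proof.
move=> approx; apply/fpsP => n; have [f' [g' [f'g' ff' gg']]] := approx n.
by rewrite -(fps_eqmodM ff' gg') // -f'g' /= ff'.
Qed.

Lemma fps_cvg_eqmod (P : nat -> fps R) f n :
  fps_cvg P f -> exists N0, forall N, (N0 <= N)%N -> fps_eqmod n (P N) f.
Proof.
move=> Pf; elim: n => [|n [N0 HN0]].
  have [N0 _ HN0] := Pf 0%N; exists N0 => N leN i; rewrite leqn0 => /eqP->.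
  exact: HN0.
have [N1 _ HN1] := Pf n.+1; exists (maxn N0 N1) => N; rewrite geq_max.
move=> /andP[le0N le1N] i; rewrite leq_eqVlt => /predU1P[->|]; first exact: HN1.
by rewrite ltnS; apply: HN0.
Qed.

(** The quotient h of the two series satisfies D h = 0 modulo t^(n+1), so that
    i h_i = 0 for every i <= n. *)
Lemma logder_inj n f f' g g' :
    (forall m : nat, (m.+1%:R : R) \is a GRing.unit) ->
    coefs f 0 = 1 -> coefs f' 0 = 1 ->
    logder f g -> logder f' g' -> fps_eqmod n g g' ->
  fps_eqmod n f f'.
Proof.
move=> natU f0 f'0 fg f'g' gg'.
have f'U : f' \is a GRing.unit by rewrite fps_unitE f'0 unitr1.
have hE : logder (f / f') (g - g') := logderM fg (logderV f'U f'g').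
suff h1 : fps_eqmod n (f / f') 1.
  rewrite -[f](divrK f'U) -[in X in fps_eqmod _ _ X](mul1r f').
  exact: fps_eqmodM.
have h0 : coefs (f / f') 0 = 1.
  have := congr1 (fun u => coefs u 0) (divrK f'U f).
  by rewrite (coefsM0 (f / f')) f'0 mulr1 f0.
case=> [|i] le_in; first by rewrite h0 coefs1.
apply: (mulIr (natU i)); rewrite coefs1 mul0r mulr_natr.
rewrite -[LHS]/(coefs (fps_euler _) i.+1) hE coefsM big1 // => k _.
by rewrite coefsB gg' ?subrr ?mulr0 // (leq_trans (leq_subr _ _)).
Qed.

End LogarithmicDerivative.

(** * The logarithmic derivative of the product series *)

Section ProductSeries.
Variable R : comUnitRingType.

(** [- sum_(k >= 1) m x^k t^(m k)] *)
Definition binom_logder (x : R) (m : nat) : fps R :=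
  FPS (fun n => if (0 < n)%N && (m %| n)%N then - (m%:R * x ^+ (n %/ m)) else 0).

(** Multiplying the series by 1 - x t^m telescopes to its first term, which is
    - m x t^m = D (1 - x t^m). *)
Lemma logder_binom x m :
  (0 < m)%N -> logder (1 - fps_monom x m) (binom_logder x m).
Proof.
move=> m0; apply/fpsP => n.
rewrite mulrBl mul1r coefsB coefs_monomM /=.
have [->|n0] := posnP n; first by rewrite mulr0n leqNgt m0 subr0.
rewrite sub0r; case: (ltngtP m n) => [lt_mn|lt_nm|eq_mn].
- rewrite subn_gt0 lt_mn /= dvdn_subl ?(ltnW lt_mn) //.
  rewrite oppr0 mul0rn; case: ifP => [/dvdnP[q n_qm]|_]; last by rewrite mulr0 subr0.
  case: q n_qm => [|q] n_qm; first by rewrite n_qm in n0.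
  rewrite n_qm mulnK // mulSn addKn mulnK // mulrN opprK exprS.
  by rewrite mulrCA addNr.
- by rewrite oppr0 mul0rn addr0 gtnNdvd.
- by rewrite -eq_mn subnn dvdnn divnn m0 expr1 mulr0 subr0 mulNrn mulr_natl.
Qed.

Lemma one_sub_monom_near1 (x : R) m : fps_near1 m (1 - fps_monom x m).
Proof. by move=> i lt_im; rewrite coefsB /= (ltn_eqF lt_im) subr0. Qed.

(** The coefficient of t^n of the limit only involves the factors with m <= n;
    among them, the divisors of n are the ones that contribute.  Degree 0 is set
    apart because [divisors 0] is [[:: 1]], which would count m = 1. *)
Lemma logder_fps_prod (x : R) (A : set nat) (c : int) : ~ A 0%N ->
  logder (fps_prod A (fun m => (1 - fps_monom x m) ^ c))
    (FPS (fun n => if n is 0 then 0 else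
       - (c%:~R * \sum_(d <- divisors n | d \in A) d%:R * x ^+ (n %/ d)))).
Proof.
move=> A0; have A_gt0 m : m \in A -> (0 < m)%N.
  by rewrite inE; case: m => // /A0.
apply: logder_approx => n.
have [|N0 /(_ (maxn N0 n.+1)) HN] := fps_cvg_eqmod n
    (@fps_prod_cvg _ A (fun m => (1 - fps_monom x m) ^ c) _).
  move=> m /mem_set/A_gt0 m0; apply: fps_near1_exprz => //.
  exact: one_sub_monom_near1.
set N := maxn N0 n.+1 in HN.
exists (\prod_(0 <= m < N | m \in A) (1 - fps_monom x m) ^ c),
       (\sum_(0 <= m < N | m \in A) binom_logder x m *~ c).
split; last 1 first.
- move=> i le_in; rewrite coefs_sum /=.
  under eq_bigr do rewrite coefsMz /= -mulrzl.
  case: i le_in => [|i] le_in.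
    by rewrite big1 // => m _; rewrite mulr0.
  rewrite -mulr_sumr -mulrN -sumrN; congr (_ * _).
  rewrite -big_mkcondr /= -big_filter -[RHS]big_filter.
  apply: perm_big; apply: uniq_perm;
    rewrite ?filter_uniq ?iota_uniq ?divisors_uniq //.
  move=> m; rewrite !mem_filter mem_index_iota leq0n /=.
  rewrite -dvdn_divisors //= -andbA; congr (_ && _).
  rewrite andb_idr // => /(dvdn_leq (ltn0Sn i)) le_mi.
  by rewrite leq_max orbC ltnS (leq_trans le_mi le_in).
- apply: logder_prod => m /A_gt0 m0; apply: logderXz; last exact: logder_binom.
  by rewrite fps_unitE one_sub_monom_near1 // coefs1 unitr1.
- by apply: HN; rewrite leq_maxl.
Qed.

Lemma logder_fser (s : nat) (z : 'I_s -> R) (C : 'I_s -> set nat)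
    (a : 'I_s -> int) :
  (forall j, ~ C j 0%N) ->
  logder (fser z C a) (FPS (fun n => if n is 0 then 0 else Psi z C a n)).
Proof.
move=> C0; have -> : FPS (fun n => if n is 0 then 0 else Psi z C a n) =
    \sum_(j < s) FPS (fun n => if n is 0 then 0
                               else - ((a j)%:~R * psi z C j n)).
  apply/fpsP => -[|n]; rewrite coefs_sum /=; first by rewrite big1.
  by rewrite sumrN.
by apply: logder_prod => j _; apply: logder_fps_prod.
Qed.

End ProductSeries.

(** * Products of exponentials *)

Section Exponentials.
Variable R : comUnitRingType.
Hypothesis natU : forall m : nat, (m.+1%:R : R) \is a GRing.unit.
Implicit Types x : R.

(** [exp (x t^m)] *)
Definition fps_expm x (m : nat) : fps R :=
  FPS (fun n => if (m %| n)%N then (n %/ m)`!%:R^-1 * x ^+ (n %/ m) else 0).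

Lemma coefs_expm0 x m : coefs (fps_expm x m) 0 = 1.
Proof. by rewrite /= dvdn0 div0n fact0 invr1 mul1r. Qed.

Lemma fact_unit k : ((k`!)%:R : R) \is a GRing.unit.
Proof. by rewrite -(prednK (fact_gt0 k)). Qed.

Lemma logder_expm x m :
  (0 < m)%N -> logder (fps_expm x m) (fps_monom (x *+ m) m).
Proof.
move=> m0; apply/fpsP => n; rewrite mulrC coefs_monomM /=.
have [->|n0] := posnP n; first by rewrite mulr0n leqNgt m0.
case: leqP => [le_mn|lt_nm]; last by rewrite gtnNdvd // mul0rn.
rewrite dvdn_subl //.
case: ifP => [/dvdnP[q n_qm]|_]; last by rewrite mul0rn mulr0.
case: q n_qm => [|q] n_qm; first by rewrite n_qm in n0.
rewrite n_qm mulnK // mulSn addKn mulnK //.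
rewrite -mulSn mulrnA !mulrnAl; congr (_ *+ m).
rewrite factS natrM invrM ?fact_unit // exprS -[LHS]mulr_natr.
by rewrite mulrAC divrK // mulrCA.
Qed.

Lemma expm_trunc x m n : (0 < m)%N ->
  fps_eqmod n (fps_expm x m)
    (\sum_(k < n.+1) fps_monom (k`!%:R^-1 * x ^+ k) (m * k)).
Proof.
move=> m0 i le_in; rewrite coefs_sum /=.
case: ifP => [/dvdnP[q i_qm]|m'i]; last first.
  rewrite big1 // => k _; case: eqP => // i_mk.
  by rewrite i_mk dvdn_mulr in m'i.
have lt_qn : (q < n.+1)%N.
  by rewrite ltnS (leq_trans _ le_in) // i_qm leq_pmulr.
rewrite (bigD1 (Ordinal lt_qn)) //= i_qm mulnC eqxx mulKn //.
rewrite big1 ?addr0 // => k.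
by rewrite -val_eqE /= eqn_pmul2l // eq_sym => /negbTE ->.
Qed.

(** Modulo t^(n+1) each exponential may be cut to its first n+1 terms, and
    distributing the product over these finite sums indexes the terms by all
    (k_1, ..., k_n) with entries at most n; such a term is a monomial of degree
    k_1 + 2 k_2 + ... + n k_n. *)
Lemma coefs_prod_expm n (x : 'I_n -> R) :
  coefs (\prod_(j < n) fps_expm (x j) j.+1) n =
  \sum_(k in parts n) \prod_(j < n) ((k j)`!%:R^-1 * x j ^+ k j).
Proof.
rewrite (@fps_eqmod_prod _ n _ _ _ (fun j : 'I_n => \sum_(k < n.+1)
    fps_monom (k`!%:R^-1 * x j ^+ k) (j.+1 * k))) //; last first.
  by move=> j; apply: expm_trunc.
rewrite bigA_distr_bigA /= coefs_sum [RHS]big_mkcond /=.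
apply: eq_bigr => k _; rewrite monom_prod /= inE.
by rewrite eq_sym.
Qed.

End Exponentials.

Theorem theorem3p1 (R : comUnitRingType)
    (natU : forall m : nat, (m.+1%:R : R) \is a GRing.unit)
    (s : nat) (s_ge1 : (1 <= s)%N)
    (C : 'I_s -> set nat) (C_pos : forall (j : 'I_s) (m : nat), C j m -> (0 < m)%N)
    (a : 'I_s -> int) (a_neq0 : exists j : 'I_s, a j != 0)
    (z : 'I_s -> R) (n : nat) (n_ge1 : (1 <= n)%N) :
  W z C a n =
  \sum_(k in parts n)
    (-1) ^+ (\sum_(j < n) k j)%N *
    \prod_(j < n) (((k j)`!)%:R^-1 * (Psi z C a j.+1 / j.+1%:R) ^+ k j).
Proof.
have C0 j : ~ C j 0%N by move=> /C_pos.
have fU := fser_unit z a C0.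
pose x (j : 'I_n) := - (Psi z C a j.+1 / j.+1%:R).
transitivity (coefs (\prod_(j < n) fps_expm (x j) j.+1) n); last first.
  rewrite coefs_prod_expm; apply: eq_bigr => k _.
  rewrite (big_morph _ (exprD _) (expr0 _)) -big_split /=.
  by apply: eq_bigr => j _; rewrite /x [in LHS]exprNn mulrCA.
have x_logder : logder (\prod_(j < n) fps_expm (x j) j.+1)
    (\sum_(j < n) fps_monom (x j *+ j.+1) j.+1).
  by apply: logder_prod => j _; apply: logder_expm.
apply: (logder_inj natU _ _ (logderV fU (logder_fser z a C0)) x_logder _
          (leqnn n)).
- have := coefsM0 (fser z C a) (fser z C a)^-1.
  by rewrite divrr // coefs_fser0 // mul1r coefs1.
- elim/big_ind: _ => [|f g f0 g0|j _]; first by rewrite coefs1.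
    by rewrite coefsM0 f0 g0 mulr1.
  exact: coefs_expm0.
case=> [|i] lt_in; rewrite coefs_sum coefsN /=.
  by rewrite big1 ?oppr0.
rewrite (bigD1 (Ordinal lt_in)) //= eqxx big1 ?addr0 => [|j].
  by rewrite /x mulNrn -mulrnAr -[_^-1 *+ _]mulr_natr mulVr ?natU ?mulr1.
by rewrite -val_eqE /= eqSS eq_sym => /negbTE ->.
Qed.
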